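(* (Downward Löwenheim–Skolem.) Let $\Sigma$ be an at most countable transition-algebra signature and $\Gamma$ a set of $\Sigma$-sentences that is consistent, i.e., $\Gamma\not\vdash_\Sigma\bot$. Then there exists a countable $\Sigma$-model $\mathfrak A$ (every carrier at most countable) with $\mathfrak A\models\Gamma$.
   Context: Transition algebra (TA). A signature $\Sigma=(S,F\supseteq M,L)$ consists of a set $S$ of sorts, function symbols $F=\{F_{w,s}\}$, monotonic function symbols $M\subseteq F$ and transition labels $L$; it is at most countable if $S$, $F$, $L$ are. A $\Sigma$-model $\mathfrak A$ is a many-sorted $(S,F)$-algebra (carriers may be empty) with relations $\lambda^{\mathfrak A}_s\subseteq\mathfrak A_s\times\mathfrak A_s$ for $\lambda\in L$ such that each $\sigma\in M$ is monotone in each argument (if $(a_k,b)\in\lambda^{\mathfrak A}$ then $(\sigma^{\mathfrak A}(\dots,a_k,\dots),\sigma^{\mathfrak A}(\dots,b,\dots))\in\lambda^{\mathfrak A}$). Actions $\mathfrak a::=\lambda\mid\mathfrak a\mathbin{;}\mathfrak a\mid\mathfrak a\cup\mathfrak a\mid\mathfrak a^*$, interpreted by $\lambda^{\mathfrak A}$, relational composition, union and reflexive–transitive closure; $\mathfrak a^n$ is the $n$-fold composition (for $n=0$, $t_1\stackrel{\mathfrak a^0}\Rightarrow t_2$ is read as $t_1=t_2$). Sentences $\phi::=t_1=t_2\mid t_1\stackrel{\mathfrak a}\Rightarrow t_2\mid\neg\phi\mid\bigvee\Phi\mid\exists X\,\phi'$ (ground terms, finite $\Phi$, finite variable set $X$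 added as new constants giving $\Sigma[X]$, $\phi'\in\mathrm{Sen}(\Sigma[X])$); $\bot:=\bigvee\emptyset$. Satisfaction: $t_1=t_2$ iff equal values; $t_1\stackrel{\mathfrak a}\Rightarrow t_2$ iff the pair of values is in $\mathfrak a^{\mathfrak A}$; $\neg$, $\bigvee$ classical; $\exists X\phi'$ iff some valuation of $X$ in $\mathfrak A$ satisfies $\phi'$. Substitutions $\theta\colon X\to T_\Sigma$ (ground terms) act on sentences. Dynamic entailment $\vdash$: the least family $\vdash_\Sigma\subseteq\mathcal P(\mathrm{Sen}(\Sigma))^2$ closed under Monotonicity ($\Gamma\supseteq\Phi\Rightarrow\Gamma\vdash\Phi$), Transitivity, Union, Translation along signature morphisms, and: (R) $\Gamma\vdash t=t$; (S),(T) symmetry and transitivity of $=$; (F) $\Gamma\vdash t_i=t_i'$ for all $i$ gives $\Gamma\vdash\sigma(\bar t)=\sigma(\bar t')$; (P) $\Gamma\vdash t_1=t_1'$, $\Gamma\vdash t_2=t_2'$, $\Gamma\vdash t_1\stackrel{\lambda}\Rightarrow t_2$ give $\Gamma\vdash t_1'\stackrel{\lambda}\Rightarrow t_2'$; (M) for $f\in M$, $\Gamma\vdash t_j\stackrel{\lambda}\Rightarrow u_j$ gives $\Gamma\vdash f(\dots,t_j,\dots)\stackrel{\lambda}\Rightarrow f(\dots,u_j,\dots)$; (Comp$_I$) from $t_1\stackrel{\mathfrak a_1}\Rightarrow t$ and $t\stackrel{\mathfrak a_2}\Rightarrow t_2$ infer $t_1\stackrel{\mathfrak a_1;\mathfrak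 a_2}\Rightarrow t_2$; (Comp$_E$) if $\Gamma\vdash_\Sigma t_1\stackrel{\mathfrak a_1;\mathfrak a_2}\Rightarrow t_2$ and $\Gamma\cup\{t_1\stackrel{\mathfrak a_1}\Rightarrow x,x\stackrel{\mathfrak a_2}\Rightarrow t_2\}\vdash_{\Sigma[x]}\phi$ ($x$ new constant of the sort of $t_1$, $\phi\in\mathrm{Sen}(\Sigma)$) then $\Gamma\vdash_\Sigma\phi$; (Union$_I$) from $t_1\stackrel{\mathfrak a_i}\Rightarrow t_2$ infer $t_1\stackrel{\mathfrak a_1\cup\mathfrak a_2}\Rightarrow t_2$; (Union$_E$) if $\Gamma\vdash t_1\stackrel{\mathfrak a_1\cup\mathfrak a_2}\Rightarrow t_2$ and $\Gamma\cup\{t_1\stackrel{\mathfrak a_i}\Rightarrow t_2\}\vdash\phi$ for $i=1,2$ then $\Gamma\vdash\phi$; (Star$_I$) from $t_1\stackrel{\mathfrak a^n}\Rightarrow t_2$ (some $n$) infer $t_1\stackrel{\mathfrak a^*}\Rightarrow t_2$; (Star$_E$) if $\Gamma\vdash t_1\stackrel{\mathfrak a^*}\Rightarrow t_2$ and $\Gamma\cup\{t_1\stackrel{\mathfrak a^n}\Rightarrow t_2\}\vdash\phi$ for all $n\in\omega$ then $\Gamma\vdash\phi$; (Neg$_D$) $\Gamma\vdash\neg\neg\phi$ gives $\Gamma\vdash\phi$; (False) $\Gamma\vdash\bot$ gives $\Gamma\vdash\phi$; (Neg$_I$) $\Gamma\cup\{\phi\}\vdash\bot$ gives $\Gamma\vdash\neg\phi$;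 (Neg$_E$) $\Gamma\vdash\neg\phi$ gives $\Gamma\cup\{\phi\}\vdash\bot$; (Disj$_I$) $\Gamma\vdash\phi$, $\phi\in\Phi$ give $\Gamma\vdash\bigvee\Phi$; (Disj$_E$) $\Gamma\vdash\bigvee\Phi$ and $\Gamma\cup\{\phi\}\vdash\gamma$ for all $\phi\in\Phi$ give $\Gamma\vdash\gamma$; (Quant$_I$) $\Gamma\cup\{\phi\}\vdash_{\Sigma[X]}\gamma$ gives $\Gamma\cup\{\exists X\phi\}\vdash_\Sigma\gamma$; (Quant$_E$) the converse; (Subst) $\Gamma\vdash_\Sigma\theta(\phi)$ for $\theta\colon X\to T_\Sigma$ gives $\Gamma\vdash_\Sigma\exists X\phi$. *)

(* Defs.v *)
From mathcomp Require Import all_boot.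
From mathcomp Require Import boolp classical_sets functions cardinality.
From Stdlib Require Import Relation_Operators.
From Stdlib Require List.

Set Implicit Arguments.
Unset Strict Implicit.
Unset Printing Implicit Defensive.

Local Open Scope classical_set_scope.

(* An arity w = s_0 ... s_{n-1} is a function 'I_n -> S rather than a list, so
   that the image of w under a map h of sorts is the composition of w with h;
   for h the identity this is convertible to w, and no casts are needed.
   [func w s] is the set F_{w,s}, and [mono] is the subfamily M of F. *)
Record signature := Signature {
  sorts : Type;
  func : forall n : nat, ('I_n -> sorts) -> sorts -> Type;
  mono : forall (n : nat) (w : 'I_n -> sorts) (s : sorts), func w s -> Prop;
  label : Type }.

Definition countable_signature (Sg : signature) : Prop :=
  [/\ countable [set: sorts Sg],
      countable [set: {n : nat & {w : 'I_n -> sorts Sg &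
                       {s : sorts Sg & func w s}}}]
    & countable [set: label Sg]].

Section Extension.
Variables (Sg : signature) (m : nat) (X : 'I_m -> sorts Sg).

(* The variable i : 'I_m of sort X i becomes a constant. The argument w of
   [ext_new] is the empty arity, which is unique by functional extensionality;
   leaving it arbitrary keeps these constants stable under maps of sorts. *)
Inductive ext_func : forall n : nat, ('I_n -> sorts Sg) -> sorts Sg -> Type :=
| ext_old n (w : 'I_n -> sorts Sg) s (f : func w s) : ext_func w s
| ext_new (w : 'I_0 -> sorts Sg) (i : 'I_m) : ext_func w (X i).

Definition ext_mono n (w : 'I_n -> sorts Sg) s (f : ext_func w s) : Prop :=
  match f with
  | ext_old _ _ _ g => mono g
  | ext_new _ _ => False
  end.

Definition ext : signature := Signature ext_mono (label Sg).

End Extension.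

Inductive term (Sg : signature) : sorts Sg -> Type :=
| App n (w : 'I_n -> sorts Sg) s (f : func w s) (ts : forall i, term (w i)) :
    term s.

Inductive action (L : Type) : Type :=
| Act (l : L)
| Comp (a b : action L)
| Union (a b : action L)
| Star (a : action L).

Fixpoint map_action (L L' : Type) (h : L -> L') (a : action L) : action L' :=
  match a with
  | Act l => Act (h l)
  | Comp b c => Comp (map_action h b) (map_action h c)
  | Union b c => Union (map_action h b) (map_action h c)
  | Star b => Star (map_action h b)
  end.

(* A finite set of sentences is given by a list, a finite set of variables by
   the family X of their sorts. *)
Inductive sen (Sg : signature) : Type :=
| Equ (s : sorts Sg) (t1 t2 : term s)
| Trans (s : sorts Sg) (t1 : term s) (a : action (label Sg)) (t2 : term s)
| Neg (phi : sen Sg)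
| Disj (Phi : seq (sen Sg))
| Ex (m : nat) (X : 'I_m -> sorts Sg) (phi : sen (ext X)).

Arguments Disj {Sg} Phi.

Definition Bot (Sg : signature) : sen Sg := Disj [::].
Arguments Bot {Sg}.

Fixpoint act_powS (L : Type) (a : action L) (n : nat) : action L :=
  if n is k.+1 then Comp a (act_powS a k) else a.

(* The sentence t1 =a^n=> t2, which for n = 0 is the equation t1 = t2;
   [act_powS a k] is the action a^(k+1). *)
Definition TransPow (Sg : signature) (s : sorts Sg) (t1 : term s)
    (a : action (label Sg)) (n : nat) (t2 : term s) : sen Sg :=
  if n is k.+1 then Trans t1 (act_powS a k) t2 else Equ t1 t2.

Record model (Sg : signature) := Model {
  carrier : sorts Sg -> Type;
  interp : forall n (w : 'I_n -> sorts Sg) s,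
    func w s -> (forall i, carrier (w i)) -> carrier s;
  trel : label Sg -> forall s, carrier s -> carrier s -> Prop;
  interp_mono : forall n (w : 'I_n -> sorts Sg) s (f : func w s), mono f ->
      forall (l : label Sg) (k : 'I_n) (a b : forall i, carrier (w i)),
      (forall i, i != k -> a i = b i) ->
      trel l (a k) (b k) -> trel l (interp f a) (interp f b) }.

Definition countable_model (Sg : signature) (A : model Sg) : Prop :=
  forall s : sorts Sg, countable [set: carrier A s].

Section Expansion.
Variables (Sg : signature) (A : model Sg).
Variables (m : nat) (X : 'I_m -> sorts Sg) (v : forall i, carrier A (X i)).

Definition exp_interp n (w : 'I_n -> sorts Sg) s (f : ext_func X w s) :
    (forall i, carrier A (w i)) -> carrier A s :=
  match f in ext_func _ w s
    return (forall i, carrier A (w i)) -> carrier A s with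
  | ext_old _ _ _ g => interp g
  | ext_new _ i => fun=> v i
  end.

Lemma exp_mono n (w : 'I_n -> sorts Sg) s (f : ext_func X w s) : ext_mono f ->
  forall (l : label Sg) (k : 'I_n) (a b : forall i, carrier A (w i)),
  (forall i, i != k -> a i = b i) ->
  trel l (a k) (b k) -> trel l (exp_interp f a) (exp_interp f b).
Proof. by case: f => // {}n {}w {}s f; exact: interp_mono. Qed.

(* The expansion of A to a model of Sg[X] given by the valuation v. *)
Definition expand : model (ext X) :=
  @Model (ext X) (carrier A) exp_interp (@trel Sg A) exp_mono.

End Expansion.

Fixpoint eval (Sg : signature) (A : model Sg) (s : sorts Sg) (t : term s) :
    carrier A s :=
  match t with App _ _ _ f ts => interp f (fun i => eval A (ts i)) end.

Fixpoint act_rel (Sg : signature) (A : model Sg) (s : sorts Sg)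
    (a : action (label Sg)) : carrier A s -> carrier A s -> Prop :=
  match a with
  | Act l => fun x y => trel l x y
  | Comp b c => fun x y => exists2 z, act_rel b x z & act_rel c z y
  | Union b c => fun x y => act_rel b x y \/ act_rel c x y
  | Star b => clos_refl_trans _ (act_rel b)
  end.

Fixpoint sat (Sg : signature) (phi : sen Sg) : model Sg -> Prop :=
  match phi with
  | Equ _ t1 t2 => fun A => eval A t1 = eval A t2
  | Trans _ t1 a t2 => fun A => act_rel a (eval A t1) (eval A t2)
  | Neg psi => fun A => ~ sat psi A
  | Disj Phi => fun A => foldr (fun psi P => sat psi A \/ P) False Phi
  | Ex _ X psi => fun A => exists v : (forall i, carrier A (X i)),
                             sat psi (expand v)
  end.

Definition models (Sg : signature) (A : model Sg) (G : set (sen Sg)) : Prop :=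
  forall phi, G phi -> sat phi A.

Record sigmor (Sg Sg' : signature) := SigMor {
  mor_sort : sorts Sg -> sorts Sg';
  mor_func : forall n (w : 'I_n -> sorts Sg) s,
    func w s -> func (fun i => mor_sort (w i)) (mor_sort s);
  mor_label : label Sg -> label Sg';
  mor_mono : forall n (w : 'I_n -> sorts Sg) s (f : func w s),
      mono f -> mono (mor_func f) }.

(* Syntactic maps, of which signature morphisms and substitutions are special
   cases: a function symbol is mapped to a function symbol or, if it is a
   constant, possibly to a ground term. *)
Inductive symb_image (Sg : signature) n (w : 'I_n -> sorts Sg)
    (s : sorts Sg) : Type :=
| Sym (f : func w s)
| Tm (n0 : n = 0) (t : term s).
Arguments Tm {Sg n w s}.

Record smap (Sg Sg' : signature) := SMap {
  on_sort : sorts Sg -> sorts Sg';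
  on_func : forall n (w : 'I_n -> sorts Sg) s,
    func w s -> symb_image (fun i => on_sort (w i)) (on_sort s);
  on_label : label Sg -> label Sg' }.

Definition smap_mor (Sg Sg' : signature) (chi : sigmor Sg Sg') : smap Sg Sg' :=
  @SMap Sg Sg' (mor_sort chi) (fun _ _ _ f => Sym (mor_func chi f))
    (mor_label chi).

Definition ext_incl (Sg : signature) m (X : 'I_m -> sorts Sg) : sigmor Sg (ext X) :=
  @SigMor Sg (ext X) (fun s => s) (fun _ _ _ f => ext_old X f) (fun l => l)
    (fun _ _ _ _ fM => fM).

Fixpoint tr_term (Sg Sg' : signature) (h : smap Sg Sg') (s : sorts Sg)
    (t : term s) : term (on_sort h s) :=
  match t with
  | App _ _ _ f ts =>
    match on_func h f with
    | Sym g => App g (fun i => tr_term h (ts i))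
    | Tm _ u => u
    end
  end.

Section Lift.
Variables (Sg Sg' : signature) (h : smap Sg Sg') (m : nat).
Variable X : 'I_m -> sorts Sg.

Let hX (i : 'I_m) : sorts Sg' := on_sort h (X i).

Definition lift_func n (w : 'I_n -> sorts Sg) s (f : ext_func X w s) :
    @symb_image (ext hX) n (fun i => on_sort h (w i)) (on_sort h s) :=
  match f in @ext_func _ _ _ n w s
    return @symb_image (ext hX) n (fun i => on_sort h (w i)) (on_sort h s) with
  | ext_old _ _ _ g =>
    match on_func h g with
    | Sym g' => @Sym (ext hX) _ _ _ (ext_old hX g')
    | Tm n0 t => @Tm (ext hX) _ _ _ n0 (tr_term (smap_mor (ext_incl hX)) t)
    end
  | ext_new w i =>
    @Sym (ext hX) _ _ _ (ext_new hX (fun j => on_sort h (w j)) i)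
  end.

(* The extension Sg[X] -> Sg'[X'] of h, with X' the translation of X. *)
Definition lift_smap : smap (ext X) (ext hX) :=
  @SMap (ext X) (ext hX) (on_sort h) lift_func (on_label h).

End Lift.

Fixpoint tr_sen (Sg : signature) (phi : sen Sg) :
    forall Sg' : signature, smap Sg Sg' -> sen Sg' :=
  match phi return forall Sg', smap Sg Sg' -> sen Sg' with
  | Equ _ t1 t2 => fun _ h => Equ (tr_term h t1) (tr_term h t2)
  | Trans _ t1 a t2 => fun _ h =>
      Trans (tr_term h t1) (map_action (on_label h) a) (tr_term h t2)
  | Neg psi => fun _ h => Neg (tr_sen psi h)
  | Disj Phi => fun _ h => Disj [seq tr_sen psi h | psi <- Phi]
  | Ex _ X psi => fun _ h => Ex (tr_sen psi (lift_smap h X))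
  end.

Definition translate (Sg Sg' : signature) (chi : sigmor Sg Sg')
    (phi : sen Sg) : sen Sg' := tr_sen phi (smap_mor chi).

Definition wk (Sg : signature) m (X : 'I_m -> sorts Sg) :
    sen Sg -> sen (ext X) :=
  translate (ext_incl X).

Section Substitution.
Variables (Sg : signature) (m : nat) (X : 'I_m -> sorts Sg).
Variable theta : forall i, @term Sg (X i).

Definition subst_func n (w : 'I_n -> sorts Sg) s (f : ext_func X w s) :
    @symb_image Sg n w s :=
  match f in @ext_func _ _ _ n w s return @symb_image Sg n w s with
  | ext_old _ _ _ g => Sym g
  | ext_new _ i => Tm erefl (theta i)
  end.

Definition smap_subst : smap (ext X) Sg :=
  @SMap (ext X) Sg (fun s => s) subst_func (fun l => l).

Definition subst (phi : sen (ext X)) : sen Sg := tr_sen phi smap_subst.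

End Substitution.

(* A term of Sg as a term of Sg[X], and a variable of X as a term of Sg[X]. *)
Definition wk_term (Sg : signature) m (X : 'I_m -> sorts Sg) (s : sorts Sg)
    (t : @term Sg s) : @term (ext X) s := tr_term (smap_mor (ext_incl X)) t.

Definition var (Sg : signature) m (X : 'I_m -> sorts Sg) (i : 'I_m) :
    @term (ext X) (X i) :=
  @App (ext X) 0 _ _
    (ext_new X (fun j : 'I_0 => False_rect _ (notF (ltn_ord j))) i)
    (fun j : 'I_0 => False_rect _ (notF (ltn_ord j))).

Reserved Notation "G ⊢ Phi" (at level 70, no associativity).

Inductive entails :
  forall Sg : signature, set (sen Sg) -> set (sen Sg) -> Prop :=
| Monotonicity Sg (G Phi : set (sen Sg)) :
    Phi `<=` G -> G ⊢ Phi
| Transitivity Sg (G Phi Psi : set (sen Sg)) :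
    G ⊢ Phi -> Phi ⊢ Psi -> G ⊢ Psi
| Unions Sg (G Phi : set (sen Sg)) :
    (forall phi, Phi phi -> G ⊢ [set phi]) -> G ⊢ Phi
| Translation Sg Sg' (chi : sigmor Sg Sg') (G Phi : set (sen Sg)) :
    G ⊢ Phi -> translate chi @` G ⊢ translate chi @` Phi
| Refl Sg (G : set (sen Sg)) s (t : term s) :
    G ⊢ [set Equ t t]
| Symm Sg (G : set (sen Sg)) s (t1 t2 : term s) :
    G ⊢ [set Equ t1 t2] -> G ⊢ [set Equ t2 t1]
| EqTrans Sg (G : set (sen Sg)) s (t1 t2 t3 : term s) :
    G ⊢ [set Equ t1 t2] -> G ⊢ [set Equ t2 t3] -> G ⊢ [set Equ t1 t3]
| Fcong Sg (G : set (sen Sg)) n (w : 'I_n -> sorts Sg) s (f : func w s)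
    (ts ts' : forall i, term (w i)) :
    (forall i, G ⊢ [set Equ (ts i) (ts' i)]) ->
    G ⊢ [set Equ (App f ts) (App f ts')]
| Pcong Sg (G : set (sen Sg)) s (t1 t1' t2 t2' : term s) (l : label Sg) :
    G ⊢ [set Equ t1 t1'] -> G ⊢ [set Equ t2 t2'] ->
    G ⊢ [set Trans t1 (Act l) t2] -> G ⊢ [set Trans t1' (Act l) t2']
| Mono Sg (G : set (sen Sg)) n (w : 'I_n -> sorts Sg) s (f : func w s)
    (l : label Sg) (j : 'I_n) (ts us : forall i, term (w i)) :
    mono f -> (forall i, i != j -> ts i = us i) ->
    G ⊢ [set Trans (ts j) (Act l) (us j)] ->
    G ⊢ [set Trans (App f ts) (Act l) (App f us)]
| CompI Sg (G : set (sen Sg)) s (t1 t t2 : term s) a1 a2 :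
    G ⊢ [set Trans t1 a1 t] -> G ⊢ [set Trans t a2 t2] ->
    G ⊢ [set Trans t1 (Comp a1 a2) t2]
| CompE Sg (G : set (sen Sg)) s (t1 t2 : term s) a1 a2 (phi : sen Sg) :
    let X := fun _ : 'I_1 => s in
    let x : @term (ext X) s := var X ord0 in
    G ⊢ [set Trans t1 (Comp a1 a2) t2] ->
    wk X @` G `|` [set Trans (wk_term X t1) a1 x; Trans x a2 (wk_term X t2)]
      ⊢ [set wk X phi] ->
    G ⊢ [set phi]
| UnionIl Sg (G : set (sen Sg)) s (t1 t2 : term s) a1 a2 :
    G ⊢ [set Trans t1 a1 t2] -> G ⊢ [set Trans t1 (Union a1 a2) t2]
| UnionIr Sg (G : set (sen Sg)) s (t1 t2 : term s) a1 a2 :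
    G ⊢ [set Trans t1 a2 t2] -> G ⊢ [set Trans t1 (Union a1 a2) t2]
| UnionE Sg (G : set (sen Sg)) s (t1 t2 : term s) a1 a2 (phi : sen Sg) :
    G ⊢ [set Trans t1 (Union a1 a2) t2] ->
    G `|` [set Trans t1 a1 t2] ⊢ [set phi] ->
    G `|` [set Trans t1 a2 t2] ⊢ [set phi] ->
    G ⊢ [set phi]
| StarI Sg (G : set (sen Sg)) s (t1 t2 : term s) a (n : nat) :
    G ⊢ [set TransPow t1 a n t2] -> G ⊢ [set Trans t1 (Star a) t2]
| StarE Sg (G : set (sen Sg)) s (t1 t2 : term s) a (phi : sen Sg) :
    G ⊢ [set Trans t1 (Star a) t2] ->
    (forall n : nat, G `|` [set TransPow t1 a n t2] ⊢ [set phi]) ->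
    G ⊢ [set phi]
| NegD Sg (G : set (sen Sg)) (phi : sen Sg) :
    G ⊢ [set Neg (Neg phi)] -> G ⊢ [set phi]
| FalseE Sg (G : set (sen Sg)) (phi : sen Sg) :
    G ⊢ [set Bot] -> G ⊢ [set phi]
| NegI Sg (G : set (sen Sg)) (phi : sen Sg) :
    G `|` [set phi] ⊢ [set Bot] -> G ⊢ [set Neg phi]
| NegE Sg (G : set (sen Sg)) (phi : sen Sg) :
    G ⊢ [set Neg phi] -> G `|` [set phi] ⊢ [set Bot]
| DisjI Sg (G : set (sen Sg)) (phi : sen Sg) (Phi : seq (sen Sg)) :
    List.In phi Phi -> G ⊢ [set phi] -> G ⊢ [set Disj Phi]
| DisjE Sg (G : set (sen Sg)) (Phi : seq (sen Sg)) (gamma : sen Sg) :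
    G ⊢ [set Disj Phi] ->
    (forall phi, List.In phi Phi -> G `|` [set phi] ⊢ [set gamma]) ->
    G ⊢ [set gamma]
| QuantI Sg (G : set (sen Sg)) m (X : 'I_m -> sorts Sg) (phi : sen (ext X))
    (gamma : sen Sg) :
    wk X @` G `|` [set phi] ⊢ [set wk X gamma] ->
    G `|` [set Ex phi] ⊢ [set gamma]
| QuantE Sg (G : set (sen Sg)) m (X : 'I_m -> sorts Sg) (phi : sen (ext X))
    (gamma : sen Sg) :
    G `|` [set Ex phi] ⊢ [set gamma] ->
    wk X @` G `|` [set phi] ⊢ [set wk X gamma]
| Subst Sg (G : set (sen Sg)) m (X : 'I_m -> sorts Sg)
    (theta : forall i, @term Sg (X i)) (phi : sen (ext X)) :
    G ⊢ [set subst theta phi] -> G ⊢ [set Ex phi]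
where "G ⊢ Phi" := (@entails _ G Phi).

Definition consistent (Sg : signature) (G : set (sen Sg)) : Prop :=
  ~ (G ⊢ [set Bot]).

(* Main.v *)
(** Henkin's method with finitely many new constants at a time. Since the rule
    for [Star] is infinitary, consistency need not survive the union of a chain
    of theories; but in the chain below each stage adds a finite block of
    constants and finitely many sentences, and only the single stages have to
    be consistent. The elimination rules say exactly that a consistent theory
    can be extended consistently by a witness: a new constant for [Comp] (CompE)
    and for existential sentences (QuantI), an exponent for [Star] (StarE), a
    disjunct for [Union] and [Disj]. By countability of the syntax every
    sentence of every stage gets decided and witnessed at a later stage. Terms
    of all stages, modulo the equations that eventually hold, form a countable
    model in which truth coincides with eventual membership in the chain. *)

Require Import Defs.
From mathcomp Require Import all_boot.
From mathcomp Require Import boolp classical_sets functions cardinality.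
From Stdlib Require Import Relation_Operators Operators_Properties.
From Stdlib Require List.

Set Implicit Arguments.
Unset Strict Implicit.
Unset Printing Implicit Defensive.

Local Open Scope classical_set_scope.

(** * Preliminaries: empty arities, induction on sentences, size of a sentence *)

Lemma mem_In (T : eqType) (x : T) (l : seq T) : x \in l -> List.In x l.
Proof.
by elim: l => //= y l IH; rewrite inE => /orP[/eqP->|/IH]; [left|right].
Qed.

Lemma map_action_id (L : Type) (a : action L) : map_action (fun l => l) a = a.
Proof. by elim: a => //= [a -> b ->|a -> b ->|a ->]. Qed.

(** [var] fixes one empty arity and one empty family of arguments; by functional extensionality any
    other choice gives the same term. *)
Lemma var_app Sg m (X : 'I_m -> sorts Sg) i (w : 'I_0 -> sorts Sg)
    (vs : forall j, @term (ext X) (w j)) :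
  var X i = @App (ext X) 0 w _ (ext_new X w i) vs.
Proof.
have key (w1 w2 : 'I_0 -> sorts Sg) (vs1 : forall j, @term (ext X) (w1 j))
    (vs2 : forall j, @term (ext X) (w2 j)) :
    @App (ext X) 0 w1 _ (ext_new X w1 i) vs1 =
    @App (ext X) 0 w2 _ (ext_new X w2 i) vs2.
  have E : w1 = w2 by apply: functional_extensionality_dep; case.
  case: _ / E vs2 => vs2; congr App.
  by apply: functional_extensionality_dep; case.
exact: key.
Qed.

Section SenInduction.
Variable P : forall Sg : signature, sen Sg -> Prop.
Hypothesis PEqu : forall Sg s (t1 t2 : term s), P (@Equ Sg s t1 t2).
Hypothesis PTrans :
  forall Sg s (t1 : term s) a (t2 : term s), P (@Trans Sg s t1 a t2).
Hypothesis PNeg : forall Sg (phi : sen Sg), P phi -> P (Neg phi).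
Hypothesis PDisj : forall Sg (Phi : seq (sen Sg)),
  (forall phi, List.In phi Phi -> P phi) -> P (Disj Phi).
Hypothesis PEx : forall Sg m (X : 'I_m -> sorts Sg) (phi : sen (ext X)),
  P phi -> P (Ex phi).

(** The generated principle gives no hypothesis for the members of the list under [Disj]; the inner
    [fix] supplies it. [P] ranges over all signatures because [Ex] changes the signature. *)
Fixpoint sen_nested_ind Sg (phi : sen Sg) : P phi :=
  match phi with
  | Equ _ t1 t2 => PEqu t1 t2
  | Trans _ t1 a t2 => PTrans t1 a t2
  | Neg psi => PNeg (sen_nested_ind psi)
  | Disj Phi => PDisj
     ((fix all_in (l : seq (sen _)) : forall psi, List.In psi l -> P psi :=
        match l with
        | [::] => fun psi h => match h with end
        | psi0 :: l' => fun psi h =>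
          match h with
          | or_introl e => eq_ind _ (fun x => P x) (sen_nested_ind psi0) _ e
          | or_intror h' => all_in l' psi h'
          end
        end) Phi)
  | Ex _ _ psi => PEx (sen_nested_ind psi)
  end.

End SenInduction.

(** The measure for the truth lemma. Atoms weigh 0 whatever their terms and actions, so translation
    and substitution preserve the size. *)
Fixpoint sen_size Sg (phi : sen Sg) : nat :=
  match phi with
  | Equ _ _ _ | Trans _ _ _ _ => 0
  | Neg psi => (sen_size psi).+1
  | Disj Phi => (foldr (fun psi n => sen_size psi + n) 0 Phi).+1
  | Ex _ _ psi => (sen_size psi).+1
  end.

Lemma sen_size_tr Sg (phi : sen Sg) Sg' (h : smap Sg Sg') :
  sen_size (tr_sen phi h) = sen_size phi.
Proof.
elim/sen_nested_ind: phi Sg' h => {Sg} //= Sg.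
- by move=> phi IH Sg' h; rewrite IH.
- move=> Phi IH Sg' h; congr _.+1; elim: Phi IH => //= phi Phi IHl IH.
  by rewrite IH ?IHl //=; [move=> psi psiP; apply: IH; right | left].
- by move=> m X phi IH Sg' h; rewrite IH.
Qed.

Lemma sen_size_disj Sg (Phi : seq (sen Sg)) phi :
  List.In phi Phi -> sen_size phi < sen_size (Disj Phi).
Proof.
rewrite /= ltnS; elim: Phi => //= psi Phi IH [->|/IH le]; first exact: leq_addr.
exact: leq_trans le (leq_addl _ _).
Qed.

Lemma sat_disj Sg (Phi : seq (sen Sg)) (A : model Sg) :
  sat (Disj Phi) A <-> exists2 phi, List.In phi Phi & sat phi A.
Proof.
elim: Phi => /= [|psi Phi IH]; first by split=> // -[].
split=> [[h|/IH[phi ? ?]]|[phi [<-|phiP] h]].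
- by exists psi => //; left.
- by exists phi => //; right.
- by left.
- by right; apply/IH; exists phi.
Qed.

(** * Reducts and the satisfaction condition *)

Definition preserves_mono Sg Sg' (h : smap Sg Sg') : Prop :=
  forall n (w : 'I_n -> sorts Sg) s (f : func w s), mono f ->
    match on_func h f with Sym g => mono g | Tm _ _ => True end.

Section Reduct.
Variables (Sg Sg' : signature) (h : smap Sg Sg') (hM : preserves_mono h).
Variable A : model Sg'.

Definition red_interp n (w : 'I_n -> sorts Sg) s (f : func w s)
    (a : forall i, carrier A (on_sort h (w i))) : carrier A (on_sort h s) :=
  match on_func h f with
  | Sym g => interp g a
  | Tm _ t => eval A t
  end.

Lemma red_mono n (w : 'I_n -> sorts Sg) s (f : func w s) : mono f ->
  forall (l : label Sg) (k : 'I_n) (a b : forall i, carrier A (on_sort h (w i))),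
  (forall i, i != k -> a i = b i) ->
  trel (on_label h l) (a k) (b k) ->
  trel (on_label h l) (red_interp f a) (red_interp f b).
Proof.
move=> fM l k a b; rewrite /red_interp; have := hM fM.
case: (on_func h f) => [g gM|n0]; first exact: interp_mono.
(* Only constants are mapped to terms, and a constant has no argument position [k]. *)
by have := ltn_ord k; rewrite [X in _ < X]n0.
Qed.

Definition reduct : model Sg :=
  @Model Sg (fun s => carrier A (on_sort h s)) red_interp
    (fun l s => @trel Sg' A (on_label h l) (on_sort h s)) red_mono.

Lemma eval_reduct s (t : @term Sg s) : eval reduct t = eval A (tr_term h t).
Proof.
elim: t => n w {}s f ts IH /=; rewrite /red_interp.
case: (on_func h f) => //= g; congr (interp g _).
by apply: functional_extensionality_dep => i; exact: IH.
Qed.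

Lemma act_rel_reduct (a : action (label Sg)) s :
  @act_rel Sg reduct s a = @act_rel Sg' A (on_sort h s) (map_action (on_label h) a).
Proof. by elim: a => //= [a -> b ->|a -> b ->|a ->]. Qed.

End Reduct.

(** Carriers and relations are shared, so no transport arises; the monotonicity proofs agree by
    proof irrelevance. *)
Lemma model_eq Sg (C : sorts Sg -> Type)
    (I J : forall n (w : 'I_n -> sorts Sg) s,
       func w s -> (forall i, C (w i)) -> C s)
    (R : label Sg -> forall s, C s -> C s -> Prop) IM JM :
  (forall n (w : 'I_n -> sorts Sg) s (f : func w s), I _ _ _ f = J _ _ _ f) ->
  @Model Sg C I R IM = @Model Sg C J R JM.
Proof.
move=> IJ; have E : I = J.
  by do 4!(apply: functional_extensionality_dep => ?); exact: IJ.
by case: _ / E JM => JM; rewrite (Prop_irrelevance IM JM).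
Qed.

Lemma lift_preserves_mono Sg Sg' (h : smap Sg Sg') m (X : 'I_m -> sorts Sg) :
  preserves_mono h -> preserves_mono (lift_smap h X).
Proof.
move=> hM n w s; case=> [{}n {}w {}s f|//] /= /hM.
by case: (on_func h f).
Qed.

Lemma eval_wk Sg m (X : 'I_m -> sorts Sg) (A : model Sg)
    (v : forall i, carrier A (X i)) s (t : @term Sg s) :
  eval (expand v) (tr_term (smap_mor (ext_incl X)) t) = eval A t.
Proof.
elim: t => n w {}s f ts IH /=; congr (interp f _).
by apply: functional_extensionality_dep => i; exact: IH.
Qed.

Lemma reduct_expand Sg Sg' (h : smap Sg Sg') (hM : preserves_mono h)
    (A : model Sg') m (X : 'I_m -> sorts Sg)
    (v : forall i, carrier A (on_sort h (X i))) :
  reduct (lift_preserves_mono (X := X) hM) (@expand _ A _ (on_sort h \o X) v) =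
  @expand _ (reduct hM A) _ X v.
Proof.
apply: model_eq => n w s; case=> [{}n {}w {}s f|//].
apply: functional_extensionality_dep => a; rewrite /red_interp /=.
rewrite /red_interp; case: (on_func h f) => //= n0 t.
by rewrite eval_wk.
Qed.

(** The satisfaction condition, proved once for syntactic maps so that it covers both weakening and
    substitution. The case of [Ex] is the commutation of reducts with expansions. *)
Lemma sat_tr Sg (phi : sen Sg) Sg' (h : smap Sg Sg') (hM : preserves_mono h)
    (A : model Sg') :
  sat (tr_sen phi h) A <-> sat phi (reduct hM A).
Proof.
elim/sen_nested_ind: phi Sg' h hM A => {Sg}.
- by move=> Sg s t1 t2 Sg' h hM A; rewrite /sat !eval_reduct.
- move=> Sg s t1 a t2 Sg' h hM A.
  by rewrite /sat !eval_reduct act_rel_reduct.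
- by move=> Sg phi IH Sg' h hM A /=; rewrite (IH _ _ hM).
- move=> Sg Phi IH Sg' h hM A /=; elim: Phi IH => //= phi Phi IHl IH.
  rewrite (IH _ _ _ _ hM) ?IHl //; first by move=> *; apply: IH; right.
  by left.
- move=> Sg m X phi IH Sg' h hM A /=.
  split=> -[v vP]; exists v.
  + by rewrite -reduct_expand; apply/IH.
  + by apply/(IH _ _ (lift_preserves_mono hM)); rewrite reduct_expand.
Qed.

Lemma incl_preserves_mono Sg m (X : 'I_m -> sorts Sg) :
  preserves_mono (smap_mor (ext_incl X)).
Proof. by []. Qed.

Lemma reduct_incl Sg m (X : 'I_m -> sorts Sg) (A : model Sg)
    (v : forall i, carrier A (X i)) :
  reduct (@incl_preserves_mono Sg m X) (expand v) = A.
Proof. by case: A v => C I R IM v; exact: model_eq. Qed.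

Lemma sat_wk Sg m (X : 'I_m -> sorts Sg) (A : model Sg)
    (v : forall i, carrier A (X i)) (phi : sen Sg) :
  sat (wk X phi) (expand v) <-> sat phi A.
Proof.
by rewrite /wk /translate (sat_tr _ (@incl_preserves_mono _ _ X)) reduct_incl.
Qed.

Lemma sat_wk_ex Sg m (X : 'I_m -> sorts Sg) (A : model Sg)
    (v : forall i, carrier A (X i)) m' (Y : 'I_m' -> sorts Sg)
    (phi : sen (ext Y)) (u : forall i, carrier A (Y i)) :
  sat (tr_sen phi (lift_smap (smap_mor (ext_incl X)) Y))
    (@expand _ (expand v) _ Y u) <->
  sat phi (expand u).
Proof.
rewrite (sat_tr _ (lift_preserves_mono (@incl_preserves_mono _ _ X))).
rewrite (reduct_expand (@incl_preserves_mono _ _ X) (A := expand v) (X := Y) u).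
suff -> : @expand _ (reduct (@incl_preserves_mono _ _ X) (expand v)) _ Y u =
          expand u by [].
by apply: model_eq => n w s; case.
Qed.

Lemma subst_preserves_mono Sg m (X : 'I_m -> sorts Sg)
    (theta : forall i, @term Sg (X i)) : preserves_mono (smap_subst theta).
Proof. by move=> n w s; case. Qed.

Lemma sat_subst Sg m (X : 'I_m -> sorts Sg) (theta : forall i, @term Sg (X i))
    (A : model Sg) (phi : sen (ext X)) :
  sat (subst theta phi) A <-> sat phi (expand (fun i => eval A (theta i))).
Proof.
rewrite /subst (sat_tr _ (subst_preserves_mono theta)).
suff -> : reduct (subst_preserves_mono theta) A =
          expand (fun i => eval A (theta i)) by [].
by apply: model_eq => n w s; case.
Qed.

(** * Countability of the syntax *)

Definition symbol (Sg : signature) : Type :=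
  {n : nat & {w : 'I_n -> sorts Sg & {s : sorts Sg & func w s}}}.

Definition Symbol Sg n (w : 'I_n -> sorts Sg) s (f : func w s) : symbol Sg :=
  existT _ n (existT _ w (existT _ s f)).

Record coding (Sg : signature) := Coding {
  code_sort : sorts Sg -> nat;
  code_symbol : symbol Sg -> nat;
  code_label : label Sg -> nat;
  code_sort_inj : injective code_sort;
  code_symbol_inj : injective code_symbol;
  code_label_inj : injective code_label }.

Lemma countable_coding Sg : countable_signature Sg -> exists c : coding Sg, True.
Proof.
have ctI (T : Type) : countable [set: T] -> exists f : T -> nat, injective f.
  move=> /countable_injP[f fI]; exists f => x y; apply: fI; exact: mem_set.
by case=> /ctI[f fI] /ctI[g gI] /ctI[h hI]; exists (Coding fI gI hI).
Qed.

Section ExtCoding.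
Variables (Sg : signature) (c : coding Sg) (m : nat) (X : 'I_m -> sorts Sg).

Definition ext_code_symbol (f : symbol (ext X)) : nat :=
  match projT2 (projT2 (projT2 f)) with
  | ext_old _ _ _ g => (code_symbol c (Symbol g)).*2
  | ext_new _ i => i.*2.+1
  end.

Lemma ext_code_symbol_inj : injective ext_code_symbol.
Proof.
case=> n [w [s f]] [n' [w' [s' f']]]; rewrite /ext_code_symbol /=.
case: f => [{}n {}w {}s f|{}w i]; case: f' => [{}n' {}w' {}s' f'|{}w' i'].
- move/double_inj/code_symbol_inj => E.
  pose F (g : symbol Sg) : symbol (ext X) :=
    @Symbol (ext X) _ _ _ (ext_old X (projT2 (projT2 (projT2 g)))).
  exact: (congr1 F E).
- by move/(congr1 odd); rewrite /= !odd_double.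
- by move/(congr1 odd); rewrite /= !odd_double.
- move=> /succn_inj /double_inj /ord_inj ->.
  congr (@Symbol (ext X) _ _ _ (ext_new X _ i')).
  have -> : w = w' by apply: functional_extensionality_dep; case.
  by [].
Qed.

Definition ext_coding : coding (ext X) :=
  @Coding (ext X) (code_sort c) ext_code_symbol (code_label c)
    (@code_sort_inj _ c) ext_code_symbol_inj (@code_label_inj _ c).

End ExtCoding.

Fixpoint code_term Sg (c : coding Sg) s (t : @term Sg s) : GenTree.tree nat :=
  match t with
  | App n _ _ f ts =>
    GenTree.Node (code_symbol c (Symbol f))
      (map (fun i => code_term c (ts i)) (enum 'I_n))
  end.

Lemma existT_classic_inj (I : Type) (T : I -> Type) (i : I) (x y : T i) :
  existT T i x = existT T i y -> x = y.
Proof.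
move=> e; have := projT2_eq e; rewrite /=.
by rewrite (Prop_irrelevance (projT1_eq e) (erefl i)).
Qed.

Lemma code_term_inj Sg (c : coding Sg) s (t : term s) s' (t' : term s') :
  code_term c t = code_term c t' ->
  existT (@term Sg) s t = existT (@term Sg) s' t'.
Proof.
elim: t s' t' => n w {}s f ts IH s' [n' w' {}s' f' ts'] /= [].
move=> /code_symbol_inj E.
(* Generalising to a packed symbol [Y] lets the equality of symbols be eliminated together with
   arity, sort and arguments. *)
suff key (Y : symbol Sg) (us : forall i, term (projT1 (projT2 Y) i)) :
    Symbol f = Y ->
    [seq code_term c (ts i) | i <- enum 'I_n] =
    [seq code_term c (us i) | i <- enum 'I_(projT1 Y)] ->
    existT (@term Sg) s (App f ts) =
    existT (@term Sg) (projT1 (projT2 (projT2 Y)))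
      (App (projT2 (projT2 (projT2 Y))) us).
  exact: (key (Symbol f') ts' E).
move=> EY; case: _ / EY us => us /= /eq_in_map eq_ts.
congr (existT _ s (App f _)); apply: functional_extensionality_dep => i.
by apply: existT_classic_inj; apply: (IH i); apply: eq_ts; rewrite mem_enum.
Qed.

Fixpoint code_action L (c : L -> nat) (a : action L) : GenTree.tree nat :=
  match a with
  | Act l => GenTree.Leaf (c l)
  | Comp a b => GenTree.Node 0 [:: code_action c a; code_action c b]
  | Union a b => GenTree.Node 1 [:: code_action c a; code_action c b]
  | Star a => GenTree.Node 2 [:: code_action c a]
  end.

Lemma code_action_inj L (c : L -> nat) : injective c -> injective (code_action c).
Proof.
move=> cI; elim=> [l|a IHa b IHb|a IHa b IHb|a IHa] [l'|a' b'|a' b'|a'] //= [].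
- by move/cI ->.
- by move=> /IHa -> /IHb ->.
- by move=> /IHa -> /IHb ->.
- by move=> /IHa ->.
Qed.

(** The coding is taken after the sentence because the body of [Ex] lives over a larger signature
    and is coded by [ext_coding]. *)
Fixpoint code_sen Sg (phi : sen Sg) : coding Sg -> GenTree.tree nat :=
  match phi with
  | Equ _ t1 t2 => fun c => GenTree.Node 0 [:: code_term c t1; code_term c t2]
  | Trans _ t1 a t2 => fun c => GenTree.Node 1
      [:: code_term c t1; code_action (code_label c) a; code_term c t2]
  | Neg psi => fun c => GenTree.Node 2 [:: code_sen psi c]
  | Disj Phi => fun c => GenTree.Node 3 [seq code_sen psi c | psi <- Phi]
  | Ex m X psi => fun c => GenTree.Node 4
      [:: GenTree.Node m [seq GenTree.Leaf (code_sort c (X i)) | i <- enum 'I_m];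
          code_sen psi (ext_coding c X)]
  end.

Lemma code_sen_inj Sg (c : coding Sg) (phi psi : sen Sg) :
  code_sen phi c = code_sen psi c -> phi = psi.
Proof.
elim/sen_nested_ind: phi c psi => {Sg} Sg.
- move=> s t1 t2 c [] //= s' t1' t2' [] /code_term_inj E1 /code_term_inj E2.
  have Es := congr1 (@projT1 _ _) E1; rewrite /= in Es.
  case: _ / Es t1' t2' E1 E2 => t1' t2' E1 E2.
  by rewrite (existT_classic_inj E1) (existT_classic_inj E2).
- move=> s t1 a t2 c [] //= s' t1' a' t2' [] /code_term_inj E1.
  move=> /(code_action_inj (@code_label_inj _ c)) <- /code_term_inj E2.
  have Es := congr1 (@projT1 _ _) E1; rewrite /= in Es.
  case: _ / Es t1' t2' E1 E2 => t1' t2' E1 E2.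
  by rewrite (existT_classic_inj E1) (existT_classic_inj E2).
- by move=> phi IH c [] //= psi [] /IH ->.
- move=> Phi IH c [] //= Psi [] E; congr Disj.
  elim: Phi Psi IH E => [|phi Phi IHl] [|psi Psi] //= IH [] E1 E2.
  rewrite (IH _ _ _ _ E1); last by left.
  by rewrite (IHl Psi) // => phi' phiP; apply: IH; right.
- move=> m X phi IH c [] //= m' X' psi [] Em.
  case: _ / Em X' psi => X' psi EX.
  have {}EX : X = X'.
    apply: functional_extensionality_dep => i.
    move/eq_in_map: EX => /(_ i); rewrite mem_enum => /(_ isT) [].
    exact: code_sort_inj.
  by case: _ / EX psi => psi /IH ->.
Qed.

Lemma sen_enum Sg (c : coding Sg) :
  exists e : nat -> sen Sg, forall phi, exists j, e j = phi.
Proof.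
(* Numbers that code no sentence are sent to [Bot]; for the others injectivity determines the
   value. *)
have /choice[e eP] (j : nat) : exists psi : sen Sg,
    forall phi, pickle (code_sen phi c) = j -> psi = phi.
  have [[phi phij]|no] := pselect (exists phi, pickle (code_sen phi c) = j).
    exists phi => psi; rewrite -phij => /(pcan_inj (@pickleK _)) E.
    exact/esym/(code_sen_inj E).
  by exists Bot => phi phij; case: no; exists phi.
by exists e => phi; exists (pickle (code_sen phi c)); exact: eP.
Qed.

(** * One step of the Henkin construction *)

Section Entailment.
Variable Sg : signature.
Implicit Types (G : set (sen Sg)) (phi psi : sen Sg).

Lemma entails_hyp G phi : G phi -> G ⊢ [set phi].
Proof. by move=> Gphi; apply: Monotonicity => _ ->. Qed.

Lemma entails_weaken G G' phi : G `<=` G' -> G ⊢ [set phi] -> G' ⊢ [set phi].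
Proof. by move=> GG'; apply: Transitivity; exact: Monotonicity. Qed.

Lemma entails_cut G phi psi :
  G ⊢ [set phi] -> G `|` [set phi] ⊢ [set psi] -> G ⊢ [set psi].
Proof.
move=> Gphi; apply: Transitivity; apply: Unions => chi [|->] //.
exact: entails_hyp.
Qed.

Lemma consistent_neg G phi :
  consistent G -> ~ consistent (G `|` [set phi]) ->
  consistent (G `|` [set Neg phi]).
Proof.
move=> cG /contrapT ncG; apply: contra_not cG; apply: entails_cut.
exact: NegI.
Qed.

Lemma consistent_sub G G' : G `<=` G' -> consistent G' -> consistent G.
Proof. by move=> GG'; apply: contra_not; exact: entails_weaken. Qed.

End Entailment.

(** * Extensions by a finite block of constants, and their witnesses *)

Record extension Sg := Extension {
  ext_num : nat;
  ext_var : 'I_ext_num -> sorts Sg;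
  ext_th : set (sen (ext ext_var)) }.
Arguments ext_var {Sg} e i : rename.
Arguments ext_th {Sg} e phi : rename.

(* For an existential sentence only the semantic content of the witness is
   recorded, so that no equation between families of variables is needed. *)
Definition witnessed Sg (psi : sen Sg) (r : extension Sg) : Prop :=
  match psi with
  | Trans s t1 (Comp a b) t2 => exists x : @term (ext (ext_var r)) s,
      ext_th r (Trans (wk_term _ t1) a x) /\ ext_th r (Trans x b (wk_term _ t2))
  | Trans s t1 (Union a b) t2 =>
      ext_th r (wk _ (Trans t1 a t2)) \/ ext_th r (wk _ (Trans t1 b t2))
  | Trans s t1 (Star a) t2 => exists n, ext_th r (wk _ (TransPow t1 a n t2))
  | Disj Phi => exists2 phi, List.In phi Phi & ext_th r (wk _ phi)
  | Ex m X phi => exists2 phi' : sen (ext (ext_var r)),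
      ext_th r phi' /\ sen_size phi' = sen_size phi &
      forall (A : model Sg) (v : forall i, carrier A (ext_var r i)),
        sat phi' (expand v) -> sat (Ex phi) A
  | _ => True
  end.

Record henkin_step Sg (T : set (sen Sg)) (psi : sen Sg) (r : extension Sg) :
    Prop := HenkinStep {
  step_consistent : consistent (ext_th r);
  step_sub : forall phi, T phi -> ext_th r (wk _ phi);
  step_decide :
    ext_th r (wk _ (Neg psi)) \/ ext_th r (wk _ psi) /\ witnessed psi r }.

Definition no_vars (Sg : signature) (i : 'I_0) : sorts Sg :=
  False_rect _ (notF (ltn_ord i)).

(* Extending the signature by an empty block is conservative because
   [Ex (Neg Bot)] over that block is provable. *)
Lemma consistent_no_vars (Sg : signature) (G : set (sen Sg)) :
  consistent G -> consistent (wk (no_vars Sg) @` G).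
Proof.
apply: contra_not => Gb.
have : G `|` [set @Ex Sg 0 (no_vars Sg) (Neg Bot)] ⊢ [set Bot].
  by apply: QuantI; apply: entails_weaken Gb => ? ?; left.
pose theta (i : 'I_0) : @term Sg (no_vars Sg i) := False_rect _ (notF (ltn_ord i)).
apply: entails_cut; apply: (@Subst Sg G 0 (no_vars Sg) theta (Neg Bot)).
by apply: NegI; apply: entails_hyp; right.
Qed.

(** If [psi] is inconsistent with [T], then [Neg psi] is added. Otherwise [psi] is added with a
    witness suited to its shape: if every candidate were inconsistent, the matching elimination rule
    with conclusion [Bot] would refute [T] together with [psi]. *)
Lemma henkin_step_exists Sg (T : set (sen Sg)) (psi : sen Sg) :
  consistent T -> exists r, henkin_step T psi r.
Proof.
move=> cT; pose triv G := @Extension Sg 0 (no_vars Sg) (wk _ @` G).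
have [cpsi|npsi] := pselect (consistent (T `|` [set psi])); last first.
  exists (triv (T `|` [set Neg psi])); split.
  - exact/consistent_no_vars/consistent_neg.
  - by move=> phi Tphi; exists phi => //; left.
  - by left; exists (Neg psi) => //; right.
set G := T `|` [set psi] in cpsi.
have Gpsi : G psi by right.
have TG : T `<=` G by move=> ? ?; left.
(* For witnesses that are sentences of the same signature ([Union], [Star], [Disj]) the block of
   constants is empty. *)
have add chi : consistent (G `|` [set chi]) ->
    (ext_th (triv (G `|` [set chi])) (wk _ chi) ->
     witnessed psi (triv (G `|` [set chi]))) -> exists r, henkin_step T psi r.
  move=> cchi W; exists (triv (G `|` [set chi])); split.
  - exact: consistent_no_vars.
  - by move=> phi Tphi; exists phi => //; left; apply: TG.
  - right; split; first by exists psi => //; left.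
    by apply: W; exists chi => //; right.
(* For witnesses that need new constants ([Comp], [Ex]). *)
have addW (r : extension Sg) : consistent (ext_th r) ->
    wk (ext_var r) @` G `<=` ext_th r -> witnessed psi r ->
    exists r, henkin_step T psi r.
  move=> cr Gr W; exists r; split=> //.
    by move=> phi /TG Tphi; apply: Gr; exists phi.
  by right; split=> //; apply: Gr; exists psi.
have trivial_wit : (forall chi, witnessed psi (triv (G `|` [set chi]))) ->
    exists r, henkin_step T psi r.
  move=> W; apply: (add psi) => [|_]; last exact: W.
  by apply: consistent_sub cpsi => phi [|->].
case: psi @G cpsi Gpsi TG add addW trivial_wit
  => [s t1 t2|s t1 [l|a b|a b|a] t2|phi|Phi|m X phi] G cG Gpsi TG add addW trivW.
- exact: trivW.
- exact: trivW.
- set X := fun _ : 'I_1 => s; set x := var X ord0.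
  apply: (addW (@Extension Sg 1 X (wk X @` G `|`
     [set Trans (wk_term X t1) a x; Trans x b (wk_term X t2)]))).
  + apply: contra_not cG => B; apply: (CompE (entails_hyp Gpsi)); exact: B.
  + by move=> ? ?; left.
  + by exists x; split; right; [left|right].
- have [c1|n1] := pselect (consistent (G `|` [set Trans t1 a t2])).
    by apply: (add _ c1) => W; left.
  have [c2|n2] := pselect (consistent (G `|` [set Trans t1 b t2])).
    by apply: (add _ c2) => W; right.
  by case: cG; apply: (UnionE (entails_hyp Gpsi)); exact: contrapT.
- have [[n cn]|no] :=
    pselect (exists n, consistent (G `|` [set TransPow t1 a n t2])).
    by apply: (add _ cn) => W; exists n.
  case: cG; apply: (StarE (entails_hyp Gpsi)) => n; apply: contrapT => cn.
  by apply: no; exists n.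
- exact: trivW.
- have [[phi [Pphi cphi]]|no] :=
    pselect (exists phi, List.In phi Phi /\ consistent (G `|` [set phi])).
    by apply: (add _ cphi) => W; exists phi.
  case: cG; apply: (DisjE (entails_hyp Gpsi)) => phi Pphi; apply: contrapT => c.
  by apply: no; exists phi.
- apply: (addW (@Extension Sg m X (wk X @` G `|` [set phi]))).
  + apply: contra_not cG => B; apply: (entails_cut (entails_hyp Gpsi)).
    exact: QuantI.
  + by move=> ? ?; left.
  + by exists phi => [|A v]; [split=> //; right | move=> h; exists v].
Qed.

(** * Transport along an increasing chain *)

(** Induction along the chain from stage [k], with a predicate that may mention the proof of
    [k <= n], as [up] does. *)
Lemma geq_ind k (Q : forall n, k <= n -> Prop) :
  (forall le_kk, Q k le_kk) ->
  (forall n (le_kn : k <= n) (le_kSn : k <= n.+1), Q n le_kn -> Q n.+1 le_kSn) ->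
  forall n (le_kn : k <= n), Q n le_kn.
Proof.
move=> Q0 QS n le_kn.
have [d En] : exists d, d + k = n by exists (n - k); exact: subnK.
case: _ / En le_kn => {n}; elim: d => [|d IH] le_kn; first exact: Q0.
have le_k : k <= d + k by exact: leq_addl.
exact: (QS _ le_k).
Qed.

Section Up.
Variables (P : nat -> Type) (next : forall k, P k -> P k.+1).

Fixpoint iter_next d k (u : P k) : P (d + k) :=
  if d is d'.+1 then next (iter_next d' u) else u.

Definition up k n (le_kn : k <= n) (u : P k) : P n :=
  eq_rect _ P (iter_next (n - k) u) _ (subnK le_kn).

(** The cast in [up] disappears when the target has the form [d + k]. *)
Lemma upE d k (le_k : k <= d + k) (u : P k) : up le_k u = iter_next d u.
Proof.
rewrite /up; move: (_ - k) (subnK le_k) => d' e.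
by have E := addIn e; subst d'; rewrite (eq_irrelevance e erefl).
Qed.

Lemma up_refl k (le_kk : k <= k) (u : P k) : up le_kk u = u.
Proof. exact: (@upE 0). Qed.

Lemma upS k n (le_kn : k <= n) (le_kSn : k <= n.+1) (u : P k) :
  up le_kSn u = next (up le_kn u).
Proof.
have [d En] : exists d, d + k = n by exists (n - k); exact: subnK.
by case: _ / En le_kn le_kSn => le_kn le_kSn; rewrite upE (@upE d.+1).
Qed.

Lemma up_up k n m (le_kn : k <= n) (le_nm : n <= m) (le_km : k <= m) (u : P k) :
  up le_nm (up le_kn u) = up le_km u.
Proof.
elim/geq_ind: m / le_nm le_km => [le_nn|m le_nm le_nSm IH] le_km.
  by rewrite up_refl (bool_irrelevance le_kn le_km).
by rewrite (upS le_nm) (IH (leq_trans le_kn le_nm)) -upS.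
Qed.

End Up.

(** * The Henkin chain *)

(** Consistency is moved inside the existential, with a dummy extension otherwise, so that the chain
    can be defined before its consistency is proved. *)
Lemma next_ext_subproof Sg (T : set (sen Sg)) psi :
  exists r, consistent T -> henkin_step T psi r.
Proof.
have [cT|?] := pselect (consistent T).
  by have [r rP] := henkin_step_exists psi cT; exists r.
by exists (@Extension Sg 0 (no_vars Sg) set0).
Qed.

Definition next_ext Sg (T : set (sen Sg)) psi : extension Sg :=
  sval (cid (next_ext_subproof T psi)).

Lemma next_extP Sg (T : set (sen Sg)) psi :
  consistent T -> henkin_step T psi (next_ext T psi).
Proof. exact: svalP (cid (next_ext_subproof T psi)). Qed.

Lemma enum_sen_subproof Sg :
  exists e : nat -> sen Sg, coding Sg -> forall phi, exists j, e j = phi.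
Proof.
have [[c _]|no] := pselect (exists c : coding Sg, True).
  by have [e eP] := sen_enum c; exists e.
by exists (fun=> Bot) => c; case: no; exists c.
Qed.

Definition enum_sen Sg : nat -> sen Sg := sval (cid (enum_sen_subproof Sg)).

Lemma enum_senP Sg (c : coding Sg) phi : exists j, enum_sen Sg j = phi.
Proof. exact: (svalP (cid (enum_sen_subproof Sg)) c). Qed.

(* Step [n] treats the [j]-th sentence of stage [i], where
   [n + 1 = 2 ^ i * (2 * j + 1)]; in particular [i <= n]. *)
Definition sched_stage n := logn 2 n.+1.
Definition sched_index n := (n.+1 %/ 2 ^ logn 2 n.+1)./2.

Lemma sched_surj i j :
  exists n, [/\ i <= n, sched_stage n = i & sched_index n = j].
Proof.
have gt0 : 0 < 2 ^ i * j.*2.+1 by rewrite muln_gt0 expn_gt0.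
exists (2 ^ i * j.*2.+1).-1; rewrite /sched_index /sched_stage prednK //.
have -> : logn 2 (2 ^ i * j.*2.+1) = i.
  by rewrite lognM ?expn_gt0 // lognX logn_prime // muln1 logn_coprime ?addn0 //
     coprime2n /= odd_double.
split=> //; last by rewrite mulKn ?expn_gt0 //= uphalf_double.
(* [i <= n] comes from [i < 2 ^ i]. *)
rewrite -ltnS prednK //; apply: leq_trans (@ltn_expl 2 i isT) _.
by rewrite leq_pmulr.
Qed.

Section Chain.
Variables (S L : Type).

(* Sorts and labels are parameters rather than fields, so that the sorts of all
   stages of the chain are convertible and no casts between them occur. The
   field [st_queue] lists, for each earlier stage, an enumeration of the
   sentences of that stage, translated to the present signature. *)
Record state := State {
  st_func : forall n, ('I_n -> S) -> S -> Type;
  st_mono : forall n (w : 'I_n -> S) s, st_func w s -> Prop;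
  st_th : set (sen (@Signature S st_func st_mono L));
  st_queue : nat -> nat -> sen (@Signature S st_func st_mono L) }.

Arguments st_th x phi : rename, clear implicits.
Arguments st_queue x i j : rename, clear implicits.

Definition st_sig (x : state) : signature :=
  @Signature S (@st_func x) (@st_mono x) L.

Definition st_ext n (x : state) : extension (st_sig x) :=
  next_ext (st_th x) (st_queue x (sched_stage n) (sched_index n)).

(** Row [n.+1] of the queue becomes an enumeration of the new stage; rows of earlier stages are
    translated, and higher rows hold placeholders until their stage is reached. *)
Definition step n (x : state) : state :=
  let r := st_ext n x in
  @State (@ext_func (st_sig x) _ (ext_var r)) (@ext_mono (st_sig x) _ (ext_var r))
    (ext_th r)
    (fun i j => if i == n.+1 then enum_sen (ext (ext_var r)) j
                else wk (ext_var r) (st_queue x i j)).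

Variables (F0 : forall n, ('I_n -> S) -> S -> Type).
Variables (M0 : forall n (w : 'I_n -> S) s, F0 w s -> Prop).
Let Sg0 := @Signature S F0 M0 L.
Variables (G0 : set (sen Sg0)) (G0_consistent : consistent G0) (c0 : coding Sg0).

Fixpoint st n : state :=
  if n is k.+1 then step k (st k) else @State F0 M0 G0 (fun=> enum_sen Sg0).

Definition Sk n : signature := st_sig (st n).
Definition Th n : set (sen (Sk n)) := st_th (st n).
Arguments Th n phi : clear implicits.
Definition rk n : extension (Sk n) := st_ext n (st n).
Definition queue n : nat -> nat -> sen (Sk n) := st_queue (st n).
Definition wks n (phi : sen (Sk n)) : sen (Sk n.+1) := wk (ext_var (rk n)) phi.
Definition wkt s n (t : @term (Sk n) s) : @term (Sk n.+1) s :=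
  wk_term (ext_var (rk n)) t.
Definition ups k n := @up (fun k => sen (Sk k)) wks k n.
Definition upt s k n := @up (fun k => @term (Sk k) s) (@wkt s) k n.

Lemma Th_consistent n : consistent (Th n).
Proof.
elim: n => [//|n IH].
exact: (step_consistent (next_extP (queue n (sched_stage n) (sched_index n)) IH)).
Qed.

Lemma Sk_coding n : exists c : coding (Sk n), True.
Proof.
elim: n => [|n [c _]]; first by exists c0.
by exists (ext_coding c (ext_var (rk n))).
Qed.

Lemma Th_wks n phi : Th n phi -> Th n.+1 (wks phi).
Proof.
exact: (step_sub (next_extP (queue n (sched_stage n) (sched_index n))
          (@Th_consistent n))).
Qed.

(** [phi] occurs in row [k] of the queue at stage [k], and the schedule treats each entry at some
    step [n >= k]. *)
Lemma decide k (phi : sen (Sk k)) : exists n (le_kn : k <= n),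
  Th n.+1 (wks (Neg (ups le_kn phi))) \/
  Th n.+1 (wks (ups le_kn phi)) /\ witnessed (ups le_kn phi) (rk n).
Proof.
have [c _] := Sk_coding k.
have [j Ej] : exists j, queue k k j = phi.
  have [j <-] := enum_senP c phi; exists j.
  by case: {c phi} k => [//|k]; rewrite /queue /= eqxx.
have [n [le_kn Ei Ej']] := sched_surj k j.
exists n, le_kn.
(* After stage [k], row [k] is only translated, since each later step overwrites a row of larger
   index. *)
suff <- : queue n (sched_stage n) (sched_index n) = ups le_kn phi.
  exact: (step_decide (next_extP (queue n (sched_stage n) (sched_index n))
          (@Th_consistent n))).
rewrite Ei Ej'; elim/geq_ind: n / le_kn {Ei Ej'} => [le_kk|n le_kn le_kSn IH].
  by rewrite /ups up_refl.
by rewrite /ups (upS _ le_kn) -/(ups le_kn phi) -IH /queue /= ltn_eqF.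
Qed.

(* [Tr phi] says that the translation of [phi] belongs to some later theory. *)
Fixpoint TrN d k (phi : sen (Sk k)) : Prop :=
  if d is d'.+1 then TrN d' (wks phi) else Th k phi.

Definition Tr k (phi : sen (Sk k)) : Prop := exists d, TrN d phi.

Lemma TrN_add d e k (phi : sen (Sk k)) : TrN d phi -> TrN (e + d) phi.
Proof.
have TrNS d' : forall k (phi : sen (Sk k)), TrN d' phi -> TrN d'.+1 phi.
  elim: d' => [|d' IH] {}k {}phi; first exact: Th_wks.
  by move=> h; exact: IH.
by move=> h; elim: e => // e IH; exact: TrNS.
Qed.

Lemma Tr_wks k (phi : sen (Sk k)) : Tr (wks phi) <-> Tr phi.
Proof.
split=> -[d dP]; first by exists d.+1.
by exists d; exact: (TrN_add 1 dP).
Qed.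

Lemma Tr_ups k n (le_kn : k <= n) (phi : sen (Sk k)) : Tr (ups le_kn phi) <-> Tr phi.
Proof.
elim/geq_ind: n / le_kn => [le_kk|n le_kn le_kSn IH]; first by rewrite /ups up_refl.
by rewrite /ups (upS _ le_kn) Tr_wks.
Qed.

Lemma Th_Tr k (phi : sen (Sk k))   : Th k phi -> Tr phi.
Proof. by exists 0. Qed.

(** Finitely many sentences reach the theory at a common stage, and that single stage is consistent.
    Finiteness is essential for the common stage. *)
Lemma Tr_consistent k (Phi : seq (sen (Sk k))) :
  (forall phi, List.In phi Phi -> Tr phi) ->
  ~ [set phi | List.In phi Phi] ⊢ [set Bot].
Proof.
move=> PhiT.
have [d dP] : exists d, forall phi, List.In phi Phi -> TrN d phi.
  elim: Phi PhiT => [|phi Phi IH] PhiT; first by exists 0.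
  have [|d dP] := IH; first by move=> ? ?; apply: PhiT; right.
  have [|e eP] := PhiT phi; first by left.
  exists (d + e) => psi [<-|/dP]; first exact: TrN_add.
  by rewrite addnC; exact: TrN_add.
elim: d k Phi dP {PhiT} => [|d IH] k Phi dP Phib.
  by apply: (@Th_consistent k); apply: entails_weaken Phib.
apply: (IH k.+1 (map (@wks k) Phi)) => [phi|].
  by move=> /List.in_map_iff[psi [<-]] /dP.
(* The rule [Translation] carries the derivation of [Bot] to the next stage. *)
have := Translation (ext_incl (ext_var (rk k))) Phib; rewrite image_set1.
apply: entails_weaken => _ [phi phiP <-]; apply/List.in_map_iff.
by exists phi.
Qed.

Lemma ups_neg k n (le_kn : k <= n) (phi : sen (Sk k)) :
  ups le_kn (Neg phi) = Neg (ups le_kn phi).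
Proof.
elim/geq_ind: n / le_kn => [le_kk|n le_kn le_kSn IH]; first by rewrite /ups !up_refl.
by rewrite /ups !(upS _ le_kn) -/(ups le_kn _) IH.
Qed.

Lemma Tr_neg k (phi : sen (Sk k)) : Tr (Neg phi) <-> ~ Tr phi.
Proof.
split=> [nT T|nT].
  apply: (@Tr_consistent k [:: Neg phi; phi]) => [psi [<-|[<-|[]]] //|].
  apply: entails_weaken (NegE (entails_hyp (G := [set Neg phi]) erefl)).
  by move=> psi [->|->] /=; [left|right; left].
have [n [le_kn [/Th_Tr/Tr_wks|[/Th_Tr/Tr_wks/Tr_ups//]]]] := decide phi.
by rewrite -ups_neg => /Tr_ups.
Qed.

(** Otherwise [Neg psi] would hold eventually, contradicting consistency of a finite set. Through
    this lemma the proof rules with finitely many premises become properties of the term model. *)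
Lemma Tr_closed k (Phi : seq (sen (Sk k))) psi :
  (forall phi, List.In phi Phi -> Tr phi) ->
  [set phi | List.In phi Phi] ⊢ [set psi] -> Tr psi.
Proof.
move=> PhiT Phipsi; apply: contrapT => /Tr_neg nT.
apply: (@Tr_consistent k (Neg psi :: Phi)) => [phi [<-|/PhiT]//|].
have sub : [set phi | List.In phi Phi] `<=` [set phi | List.In phi (Neg psi :: Phi)].
  by move=> ? ?; right.
apply: entails_cut (entails_weaken sub Phipsi) _.
by apply: NegE; apply: entails_hyp; left.
Qed.

Lemma wks_trans k s (t : @term (Sk k) s) a (t' : @term (Sk k) s) :
  wks (Trans t a t') = @Trans (Sk k.+1) s (wkt t) a (wkt t').
Proof. by rewrite /wks /wk /translate /= map_action_id. Qed.

Lemma ups_trans k n (le_kn : k <= n) s (t : @term (Sk k) s) a (t' : @term (Sk k) s) :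
  ups le_kn (Trans t a t') = @Trans (Sk n) s (upt le_kn t) a (upt le_kn t').
Proof.
elim/geq_ind: n / le_kn => [le_kk|n le_kn le_kSn IH].
  by rewrite /ups /upt !up_refl.
by rewrite /ups /upt !(upS _ le_kn) -/(ups le_kn _) IH wks_trans.
Qed.

Lemma ups_equ k n (le_kn : k <= n) s (t t' : @term (Sk k) s) :
  ups le_kn (Equ t t') = Equ (upt le_kn t) (upt le_kn t').
Proof.
elim/geq_ind: n / le_kn => [le_kk|n le_kn le_kSn IH].
  by rewrite /ups /upt !up_refl.
by rewrite /ups /upt !(upS _ le_kn) -/(ups le_kn _) IH.
Qed.

Lemma ups_pow k n (le_kn : k <= n) s (t : @term (Sk k) s) a p (t' : @term (Sk k) s) :
  ups le_kn (TransPow t a p t') =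
  @TransPow (Sk n) s (upt le_kn t) a p (upt le_kn t').
Proof. by case: p => [|p]; [exact: ups_equ | exact: ups_trans]. Qed.

(** * The term model *)

Definition raw s : Type := {k : nat & @term (Sk k) s}.

Definition raw_eq s (x y : raw s) : Prop :=
  exists n (le_xn : projT1 x <= n) (le_yn : projT1 y <= n),
    Tr (Equ (upt le_xn (projT2 x)) (upt le_yn (projT2 y))).

(** Two common stages are compared at their maximum, [Tr] being invariant under translation. *)
Lemma raw_eq_any s (x y : raw s) n (le_xn : projT1 x <= n) (le_yn : projT1 y <= n) :
  raw_eq x y -> Tr (Equ (upt le_xn (projT2 x)) (upt le_yn (projT2 y))).
Proof.
case=> m [le_xm [le_ym h]].
have le_n : n <= maxn n m := leq_maxl _ _.
have le_m : m <= maxn n m := leq_maxr _ _.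
apply/(Tr_ups le_n); rewrite ups_equ.
move/(Tr_ups le_m): h; rewrite ups_equ /upt.
by rewrite !(up_up _ _ _ (leq_trans le_xm le_m))
  !(up_up _ _ _ (leq_trans le_ym le_m)).
Qed.

Lemma Tr_equ_refl k s (t : @term (Sk k) s) : Tr (Equ t t).
Proof. by apply: (@Tr_closed k [::]) => //; exact: Refl. Qed.

Lemma Tr_equ_sym k s (t t' : @term (Sk k) s) : Tr (Equ t t') -> Tr (Equ t' t).
Proof.
move=> h; apply: (@Tr_closed k [:: Equ t t']) => [phi [<-|[]]//|].
by apply: Symm; apply: entails_hyp; left.
Qed.

Lemma Tr_equ_trans k s (t t' t'' : @term (Sk k) s) :
  Tr (Equ t t') -> Tr (Equ t' t'') -> Tr (Equ t t'').
Proof.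
move=> h h'; apply: (@Tr_closed k [:: Equ t t'; Equ t' t'']).
  by move=> phi [<-|[<-|[]]].
by apply: (@EqTrans _ _ _ _ t'); apply: entails_hyp; [left|right; left].
Qed.

Lemma raw_eq_sym s (x y : raw s) : raw_eq x y -> raw_eq y x.
Proof. by case=> n [le_xn [le_yn h]]; exists n, le_yn, le_xn; exact: Tr_equ_sym. Qed.

Lemma raw_eq_trans s (x y z : raw s) : raw_eq x y -> raw_eq y z -> raw_eq x z.
Proof.
move=> xy yz; pose n := maxn (projT1 x) (maxn (projT1 y) (projT1 z)).
have le_xn : projT1 x <= n by rewrite leq_maxl.
have le_yn : projT1 y <= n by rewrite /n maxnCA leq_maxl.
have le_zn : projT1 z <= n by rewrite /n maxnA leq_maxr.
exists n, le_xn, le_zn.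
exact: Tr_equ_trans (raw_eq_any le_xn le_yn xy) (raw_eq_any le_yn le_zn yz).
Qed.

(** The quotient of [raw s] by [raw_eq], with equivalence classes as sets, so that equality in the
    quotient is genuine equality. *)
Definition dom s : Type := {P : set (raw s) | exists x, P = raw_eq x}.

Lemma dom_ext s (x y : dom s) : sval x = sval y -> x = y.
Proof.
case: x y => [P p] [Q q] /= E; case: _ / E q => q.
by rewrite (Prop_irrelevance p q).
Qed.

Definition cls s k (t : @term (Sk k) s) : dom s :=
  exist _ (raw_eq (existT _ k t)) (ex_intro _ _ erefl).

Lemma cls_eq_raw s (x y : raw s) :
  cls (projT2 x) = cls (projT2 y) <-> raw_eq x y.
Proof.
case: x y => [k t] [k' t'] /=; split=> [[E]|h].
  rewrite E; exists k', (leqnn _), (leqnn _); exact: Tr_equ_refl.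
apply: dom_ext => /=; rewrite predeqE => z; split; last exact: raw_eq_trans.
by apply: raw_eq_trans; exact: raw_eq_sym.
Qed.

Lemma cls_eq s k (t t' : @term (Sk k) s) : cls t = cls t' <-> Tr (Equ t t').
Proof.
rewrite (cls_eq_raw (existT _ k t) (existT _ k t')); split=> [h|h].
  by have := @raw_eq_any s (existT _ k t) (existT _ k t') k (leqnn k) (leqnn k) h;
    rewrite /upt !up_refl.
by exists k, (leqnn _), (leqnn _); rewrite /upt !up_refl.
Qed.

Lemma cls_upt s k n (le_kn : k <= n) (t : @term (Sk k) s) :
  cls (upt le_kn t) = cls t.
Proof.
apply/(cls_eq_raw (existT _ n (upt le_kn t)) (existT _ k t)).
exists n, (leqnn _), le_kn; rewrite /= /upt up_refl; exact: Tr_equ_refl.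
Qed.

Lemma dom_cls s (x : dom s) : exists k (t : @term (Sk k) s), x = cls t.
Proof.
case: (svalP x) => -[k t] E; exists k, t; exact: dom_ext.
Qed.

(** Arities are finite, so the maximum of the stages of single representatives works. Allowing every
    later stage lets several such bounds be combined. *)
Lemma dom_reps m (w : 'I_m -> S) (a : forall i, dom (w i)) :
  exists N, forall n, N <= n ->
    exists us : forall i, @term (Sk n) (w i), forall i, a i = cls (us i).
Proof.
have /choice[k kP] (i : 'I_m) : exists k, exists t : @term (Sk k) (w i), a i = cls t.
  exact: dom_cls.
exists (\max_i k i) => n le_n.
have H i : exists t : @term (Sk n) (w i), a i = cls t.
  have [t ->] := kP i.
  have le_kn : k i <= n by apply: leq_trans le_n; exact: leq_bigmax.
  by exists (upt le_kn t); rewrite cls_upt.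
by exists (fun i => sval (cid (H i))) => i; exact: svalP (cid (H i)).
Qed.

(** * Interpretation of the function symbols *)

Definition upf m (w : 'I_m -> S) s k n :=
  @up (fun k => @func (Sk k) m w s) (fun k f => ext_old (ext_var (rk k)) f) k n.

Lemma upt_app k n (le_kn : k <= n) m (w : 'I_m -> S) s (f : @func (Sk k) m w s)
    (ts : forall i, @term (Sk k) (w i)) :
  upt le_kn (App f ts) = App (upf le_kn f) (fun i => upt le_kn (ts i)).
Proof.
elim/geq_ind: n / le_kn => [le_kk|n le_kn le_kSn IH].
  rewrite /upt /upf !up_refl; congr App.
  by apply: functional_extensionality_dep => i; rewrite up_refl.
rewrite /upt /upf !(upS _ le_kn) -/(upt le_kn _) IH /=; congr App.
by apply: functional_extensionality_dep => i; rewrite (upS _ le_kn).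
Qed.

Lemma cls_app k m (w : 'I_m -> S) s (f : @func (Sk k) m w s)
    (ts us : forall i, @term (Sk k) (w i)) :
  (forall i, cls (ts i) = cls (us i)) -> cls (App f ts) = cls (App f us).
Proof.
move=> E; apply/cls_eq.
apply: (@Tr_closed k [seq Equ (ts i) (us i) | i <- enum 'I_m]).
  by move=> phi /List.in_map_iff[i [<- _]]; apply/cls_eq.
apply: Fcong => i; apply: entails_hyp; apply/List.in_map_iff; exists i.
by split=> //; apply: mem_In; rewrite mem_enum.
Qed.

(** Representatives from two stages are compared at the maximum, where congruence applies. *)
Lemma base_interp_subproof m (w : 'I_m -> S) s (f : F0 w s)
    (a : forall i, dom (w i)) :
  exists y : dom s, forall n (us : forall i, @term (Sk n) (w i)),
    (forall i, a i = cls (us i)) ->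
    y = cls (App (@upf _ _ _ 0 n (leq0n n) f) us).
Proof.
have [N /(_ N (leqnn N))[us0 us0P]] := dom_reps a.
exists (cls (App (@upf _ _ _ 0 N (leq0n N) f) us0)) => n us usP.
have le_N : N <= maxn N n := leq_maxl _ _.
have le_n : n <= maxn N n := leq_maxr _ _.
rewrite -(cls_upt le_N) -[RHS](cls_upt le_n) !upt_app.
rewrite /upf !(up_up _ _ _ (leq0n _)); apply: cls_app => i.
by rewrite !cls_upt -us0P -usP.
Qed.

Definition base_interp m (w : 'I_m -> S) s (f : F0 w s) (a : forall i, dom (w i)) :
    dom s :=
  sval (cid (base_interp_subproof f a)).

Lemma base_interpE m (w : 'I_m -> S) s (f : F0 w s) n
    (us : forall i, @term (Sk n) (w i)) :
  base_interp f (fun i => cls (us i)) = cls (App (@upf _ _ _ 0 n (leq0n n) f) us).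
Proof.
exact: (svalP (cid (base_interp_subproof f (fun i => cls (us i))))).
Qed.

(** Recursion on the stage makes the interpretation at stage [k.+1] visibly an expansion of that at
    stage [k]; [dom_interpE] links it to application of terms. *)
Fixpoint dom_interp k : forall m (w : 'I_m -> S) s,
    @func (Sk k) m w s -> (forall i, dom (w i)) -> dom s :=
  match k return forall m (w : 'I_m -> S) s,
    @func (Sk k) m w s -> (forall i, dom (w i)) -> dom s with
  | 0 => base_interp
  | k'.+1 => fun m w s f =>
    match f in ext_func _ w s return (forall i, dom (w i)) -> dom s with
    | ext_old _ _ _ g => @dom_interp k' _ _ _ g
    | ext_new _ i => fun=> @cls _ k'.+1 (var (ext_var (rk k')) i)
    end
  end.

Lemma dom_interpE k n (le_kn : k <= n) m (w : 'I_m -> S) s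
    (f : @func (Sk k) m w s) (us : forall i, @term (Sk n) (w i)) :
  dom_interp f (fun i => cls (us i)) = cls (App (upf le_kn f) us).
Proof.
elim: k n le_kn m w s f us => [|k IH] n le_kn m w s f us.
  by rewrite /= base_interpE (bool_irrelevance le_kn (leq0n n)).
case: f us => {m w s} [m w s g|w i] us /=.
  rewrite (IH n (ltnW le_kn)); congr (cls (App _ us)).
  by rewrite /upf -(up_up _ (leqnSn k) le_kn (ltnW le_kn)) (upS _ (leqnn k)) up_refl.
pose vs (j : 'I_0) : @term (Sk k.+1) (w j) := False_rect _ (notF (ltn_ord j)).
have -> : var (ext_var (rk k)) i =
    @App (Sk k.+1) 0 w (ext_var (rk k) i) (ext_new (ext_var (rk k)) w i) vs.
  exact: var_app.
rewrite -(cls_upt le_kn) upt_app; congr (cls (App _ _)).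
by apply: functional_extensionality_dep; case.
Qed.

(** * Transition relations and monotonicity *)

Definition dom_rel (l : L) s (x y : dom s) : Prop :=
  exists n (t t' : @term (Sk n) s),
    [/\ x = cls t, y = cls t' & @Tr n (@Trans (Sk n) s t (Act l) t')].

Lemma dom_relE l s n (t t' : @term (Sk n) s) :
  dom_rel l (cls t) (cls t') <-> @Tr n (@Trans (Sk n) s t (Act l) t').
Proof.
split=> [[m [u [u' [Et Et' h]]]]|h]; last by exists n, t, t'.
have le_n : n <= maxn n m := leq_maxl _ _.
have le_m : m <= maxn n m := leq_maxr _ _.
move/(Tr_ups le_m): h; rewrite ups_trans => h.
apply/(Tr_ups le_n); rewrite ups_trans.
set k := maxn n m in le_n le_m h *.
apply: (@Tr_closed k [:: Equ (upt le_m u) (upt le_n t);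
  Equ (upt le_m u') (upt le_n t');
  @Trans (Sk k) s (upt le_m u) (Act l) (upt le_m u')]).
  by move=> phi [<-|[<-|[<-//|[]]]]; apply/cls_eq; rewrite !cls_upt.
apply: (@Pcong _ _ _ (upt le_m u) _ (upt le_m u')); apply: entails_hyp.
- by left.
- by right; left.
- by right; right; left.
Qed.

Lemma dom_interp_mono k m (w : 'I_m -> S) s (f : @func (Sk k) m w s) : mono f ->
  forall (l : L) (j : 'I_m) (a b : forall i, dom (w i)),
  (forall i, i != j -> a i = b i) ->
  dom_rel l (a j) (b j) -> dom_rel l (dom_interp f a) (dom_interp f b).
Proof.
elim: k m w s f => [|k IH] m w s f; last first.
  by case: f => //= {}m {}w {}s f; exact: IH.
move=> fM l j a b ab abj.
have [N1 /(_ _ (leq_maxl N1 _)) us1] := dom_reps a.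
have [N2 /(_ _ (leq_maxr N1 N2)) [us2 us2P]] := dom_reps b.
have {us1} [us1 us1P] := us1 N2; set n := maxn N1 N2 in us1 us1P us2 us2P.
(* The rule [Mono] needs arguments that agree syntactically off position [j], so one representative
   is used for both [a i] and [b i] there. *)
have H i : exists p : @term (Sk n) (w i) * @term (Sk n) (w i),
    [/\ a i = cls p.1, b i = cls p.2 & i != j -> p.1 = p.2].
  have [->|nij] := eqVneq i j; first by exists (us1 j, us2 j).
  by exists (us1 i, us1 i); split=> //=; rewrite -ab.
pose p i := sval (cid (H i)).
have pP i : [/\ a i = cls (p i).1, b i = cls (p i).2 & i != j -> (p i).1 = (p i).2].
  exact: svalP (cid (H i)).
have -> : a = fun i => cls (p i).1.
  by apply: functional_extensionality_dep => i; case: (pP i).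
have -> : b = fun i => cls (p i).2.
  by apply: functional_extensionality_dep => i; case: (pP i).
rewrite !(dom_interpE (leq0n n)); apply/dom_relE.
have [aj bj _] := pP j; rewrite aj bj in abj; move/dom_relE: abj => abj.
apply: (@Tr_closed n [:: @Trans (Sk n) _ (p j).1 (Act l) (p j).2]).
  by move=> phi [<-|[]].
apply: (@Mono (Sk n) _ m w s (upf (leq0n n) f) l j (fun i => (p i).1)
  (fun i => (p i).2)); last by apply: entails_hyp; left.
- elim/geq_ind: n / (leq0n n) {us1 us1P us2 us2P p pP H aj bj abj} => [h|n h h' IH].
    by rewrite /upf up_refl.
  by rewrite /upf (upS _ h).
- by move=> i nij; case: (pP i) => _ _ /(_ nij).
Qed.

Definition Ak k : model (Sk k) :=
  @Model (Sk k) dom (@dom_interp k) dom_rel (@dom_interp_mono k).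

Definition new_val k (i : 'I_(ext_num (rk k))) : dom (ext_var (rk k) i) :=
  @cls _ k.+1 (var (ext_var (rk k)) i).

(** All stages share domain and relations; a new stage only names elements that are already
    present. *)
Lemma AkS k : Ak k.+1 = @expand _ (Ak k) _ _ (@new_val k).
Proof. by apply: (@model_eq (Sk k.+1)) => m w s; case. Qed.

Lemma eval_Ak k s (t : @term (Sk k) s) : eval (Ak k) t = cls t.
Proof.
elim: t => m w {}s f ts IH /=.
have -> : (fun i => eval (Ak k) (ts i)) = (fun i => cls (ts i)).
  exact: functional_extensionality_dep.
by rewrite (dom_interpE (leqnn k)) /upf up_refl.
Qed.

(** * The truth lemma *)

Lemma Tr_witness k (phi : sen (Sk k)) : Tr phi ->
  exists n (le_kn : k <= n), witnessed (ups le_kn phi) (rk n).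
Proof.
move=> T; have [n [le_kn [/Th_Tr/Tr_wks/Tr_neg[]|[_ W]]]] := decide phi.
  exact/Tr_ups.
by exists n, le_kn.
Qed.

Lemma Tr_comp k s (t t' : @term (Sk k) s) a b :
  Tr (Trans t (Comp a b) t') <->
  exists m (le_km : k <= m) (u : @term (Sk m) s),
    Tr (@Trans (Sk m) s (upt le_km t) a u) /\
    Tr (@Trans (Sk m) s u b (upt le_km t')).
Proof.
split=> [/Tr_witness[n [le_kn]]|[m [le_km [u [h1 h2]]]]].
  rewrite ups_trans => -[x [h1 h2]]; exists n.+1, (leqW le_kn), x.
  by rewrite /upt !(upS _ le_kn); split; exact: (@Th_Tr n.+1).
apply/(Tr_ups le_km); rewrite ups_trans.
apply: (@Tr_closed m [:: @Trans (Sk m) s (upt le_km t) a u;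
                         @Trans (Sk m) s u b (upt le_km t')]).
  by move=> phi [<-|[<-|[]]].
by apply: (@CompI (Sk m) _ s _ u); apply: entails_hyp; [left|right; left].
Qed.

Lemma Tr_union k s (t t' : @term (Sk k) s) a b :
  Tr (Trans t (Union a b) t') <-> Tr (Trans t a t') \/ Tr (Trans t b t').
Proof.
split=> [/Tr_witness[n [le_kn]]|].
  rewrite ups_trans => -[] h; [left|right];
    by apply/(Tr_ups le_kn); rewrite ups_trans; apply/Tr_wks; exact: (@Th_Tr n.+1).
case=> h.
  apply: (@Tr_closed k [:: Trans t a t']) => [phi [<-|[]]//|].
  by apply: UnionIl; apply: entails_hyp; left.
apply: (@Tr_closed k [:: Trans t b t']) => [phi [<-|[]]//|].
by apply: UnionIr; apply: entails_hyp; left.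
Qed.

Lemma Tr_star k s (t t' : @term (Sk k) s) a :
  Tr (Trans t (Star a) t') <-> exists p, Tr (TransPow t a p t').
Proof.
split=> [/Tr_witness[n [le_kn]]|[p h]].
  rewrite ups_trans => -[p h]; exists p.
  by apply/(Tr_ups le_kn); rewrite ups_pow; apply/Tr_wks; exact: (@Th_Tr n.+1).
apply: (@Tr_closed k [:: TransPow t a p t']) => [phi [<-|[]]//|].
by apply: (@StarI _ _ _ _ _ _ p); apply: entails_hyp; left.
Qed.

(** Hence truth of transitions can be stated in the model of stage 0 for terms of any stage. *)
Lemma act_rel_Ak k (a : action L) s :
  @act_rel (Sk k) (Ak k) s a = @act_rel (Sk 0) (Ak 0) s a.
Proof. by elim: a => //= [a -> b ->|a -> b ->|a ->]. Qed.

Lemma truth_act (a : action L) (s : S) k (t t' : @term (Sk k) s) :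
  @act_rel (Sk 0) (Ak 0) s a (cls t) (cls t') <-> Tr (@Trans (Sk k) s t a t').
Proof.
elim: a k t t' => [l|a IHa b IHb|a IHa b IHb|a IHa] k t t' /=.
- exact: dom_relE.
- rewrite Tr_comp; split=> [[z h1 h2]|[m [le_km [u [h1 h2]]]]].
    have [n [u Ez]] := dom_cls z; rewrite {z}Ez in h1 h2.
    have le_k : k <= maxn k n := leq_maxl _ _.
    have le_n : n <= maxn k n := leq_maxr _ _.
    exists (maxn k n), le_k, (upt le_n u).
    by split; [apply/IHa|apply/IHb]; rewrite !cls_upt.
  by exists (cls u); [move/IHa: h1|move/IHb: h2]; rewrite cls_upt.
- by rewrite Tr_union IHa IHb.
rewrite Tr_star; split=> [h|[p]].
  (* Peeling single steps off the left matches [act_powS], which nests to the right. *)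
  have {h} := clos_rt_rt1n _ _ _ _ h.
  move Ex : (cls t) => x; move Ey : (cls t') => y h.
  elim: h k t t' Ex Ey => {x y} [x|x z y xz _ IH] k t t' Ex Ey.
    by exists 0; apply/cls_eq; rewrite Ex Ey.
  have [n [u Ez]] := dom_cls z.
  have le_k : k <= maxn k n := leq_maxl _ _.
  have le_n : n <= maxn k n := leq_maxr _ _.
  have [||p h] := IH _ (upt le_n u) (upt le_k t'); rewrite ?cls_upt //.
  exists p.+1; apply/(Tr_ups le_k); rewrite ups_pow.
  have tu : Tr (@Trans (Sk _) s (upt le_k t) a (upt le_n u)).
    by apply/IHa; rewrite !cls_upt Ex -Ez.
  (* [act_powS a 0] is [a] itself, so exponent 1 is no composition: the remaining equation is
     absorbed by passing to classes. *)
  case: p h => [|p] h.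
    by move/cls_eq: h => h; apply/IHa; rewrite -h !cls_upt Ex -Ez.
  apply/Tr_comp; exists _, (leqnn _), (upt le_n u).
  by rewrite /upt !up_refl.
elim: p k t t' => [|p IH] k t t' h; first by move/cls_eq: h => ->; exact: rt_refl.
case: p IH h => [_ /IHa|p IH /Tr_comp[m [le_km [u [/IHa h1 h2]]]]].
  exact: rt_step.
apply: (rt_trans _ _ _ (cls u)); first by rewrite cls_upt in h1; exact: rt_step.
by have := IH _ _ _ h2; rewrite cls_upt.
Qed.

Lemma ups_disj k n (le_kn : k <= n) (Phi : seq (sen (Sk k))) :
  ups le_kn (Disj Phi) = Disj [seq ups le_kn phi | phi <- Phi].
Proof.
elim/geq_ind: n / le_kn => [le_kk|n le_kn le_kSn IH].
  by rewrite /ups up_refl; under eq_map do rewrite up_refl; rewrite map_id.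
rewrite /ups (upS _ le_kn) -/(ups le_kn _) IH /wks /wk /translate /= -map_comp.
by under [in RHS]eq_map do rewrite (upS _ le_kn).
Qed.

(** The translated body is described only by its size and its meaning in the models [Ak], which is
    all that the truth lemma needs. *)
Lemma ups_ex k n (le_kn : k <= n) m (X : 'I_m -> S) (phi : sen (@ext (Sk k) m X)) :
  exists2 phi' : sen (@ext (Sk n) m X),
    ups le_kn (Ex phi) = Ex phi' /\ sen_size phi' = sen_size phi &
    forall v : (forall i, dom (X i)),
      sat phi' (@expand _ (Ak n) _ _ v) <-> sat phi (@expand _ (Ak k) _ _ v).
Proof.
elim/geq_ind: n / le_kn => [le_kk|n le_kn le_kSn [phi' [E Es] phi'P]].
  by exists phi => //; rewrite /ups up_refl.
exists (tr_sen phi' (lift_smap (smap_mor (ext_incl (ext_var (rk n)))) X)).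
  by rewrite sen_size_tr /ups (upS _ le_kn) -/(ups le_kn _) E.
move=> v; rewrite -phi'P -(@sat_wk_ex _ _ _ (Ak n) (@new_val n)).
suff -> : @expand (Sk n.+1) (Ak n.+1) _ X v =
          @expand _ (@expand _ (Ak n) _ _ (@new_val n)) _ X v by [].
by apply: (@model_eq (@ext (Sk n.+1) m X)) => m' w s; case=> // {}m' {}w {}s; case.
Qed.

Lemma Tr_disj k (Phi : seq (sen (Sk k))) :
  Tr (Disj Phi) <-> exists2 phi, List.In phi Phi & Tr phi.
Proof.
split=> [/Tr_witness[n [le_kn]]|[phi phiP h]].
  rewrite ups_disj => -[_ /List.in_map_iff[phi [<- phiP]] h].
  by exists phi => //; apply/(Tr_ups le_kn)/Tr_wks; exact: (@Th_Tr n.+1).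
apply: (@Tr_closed k [:: phi]) => [psi [<-|[]]//|].
by apply: (DisjI phiP); apply: entails_hyp; left.
Qed.

(** Induction on size, uniformly in the stage: for [Ex] the hypothesis is applied to a substitution
    instance or to a witness at a later stage, neither being a subformula. *)
Lemma truth k (phi : sen (Sk k)) : sat phi (Ak k) <-> Tr phi.
Proof.
have [N] := ubnP (sen_size phi); elim: N k phi => // N IH k phi leN.
case: phi leN => [s t t'|s t a t'|psi|Phi|m X psi] leN.
- by rewrite /= !eval_Ak cls_eq.
- by rewrite /= !eval_Ak act_rel_Ak truth_act.
- by rewrite Tr_neg -IH.
- rewrite Tr_disj sat_disj; split=> -[phi phiP h]; exists phi => //;
  by apply/IH => //; apply: leq_trans (sen_size_disj phiP) _.
split=> [[v vP]|T].
  (* Representatives [us] of the values of [v] at one stage serve as the substitution for the rule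
     [Subst]. *)
  have [M /(_ _ (leq_maxr k M))[us usP]] := dom_reps v.
  have le_k : k <= maxn k M := leq_maxl _ _; set n := maxn k M in us usP le_k.
  have [psi' [E Es] psi'P] := ups_ex le_k psi.
  apply/(Tr_ups le_k); rewrite E.
  apply: (@Tr_closed n [:: @subst (Sk n) m X us psi']); last first.
    by apply: (@Subst (Sk n) _ m X us); apply: entails_hyp; left.
  move=> phi [<-|[]]; apply/IH; first by rewrite /subst sen_size_tr Es.
  apply/sat_subst; suff -> : (fun i => eval (Ak n) (us i)) = v by apply/psi'P.
  by apply: functional_extensionality_dep => i; rewrite eval_Ak usP.
have [n [le_kn]] := Tr_witness T.
have [psi' [-> Es] psi'P] := ups_ex le_kn psi.
move=> [chi [chiT chis] chiP].
(* The witness holds at stage [n.+1], whose model expands [Ak n] by the classes of the new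
   constants; these give the valuation. *)
have [|u uP] := chiP (Ak n) (@new_val n); last by exists u; apply/psi'P.
rewrite -AkS; apply/(IH n.+1); last exact: Th_Tr.
by rewrite chis Es.
Qed.

Lemma dom_countable s : countable [set: dom s].
Proof.
have ct k : exists f : @term (Sk k) s -> nat, injective f.
  have [c _] := Sk_coding k; exists (fun t => pickle (code_term c t)) => t t'.
  move=> /(pcan_inj (@pickleK _)) E.
  exact: existT_classic_inj (code_term_inj E).
pose f k := sval (cid (ct k)).
have fI k : injective (f k) := svalP (cid (ct k)).
(* A class is coded by the stage and the term code of a chosen representative. *)
pose rep (x : dom s) : raw s := sval (cid (svalP x)).
have repP x : sval x = raw_eq (rep x) := svalP (cid (svalP x)).
apply/countable_injP; exists (fun x => pickle (projT1 (rep x), f _ (projT2 (rep x)))).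
move=> x y _ _ /(pcan_inj (@pickleK _)) E; apply: dom_ext; rewrite !repP.
congr raw_eq; case: (rep x) (rep y) E => [k t] [k' t'] /= [Ek].
by case: _ / Ek t' => t' /fI ->.
Qed.

Lemma chain_model :
  exists2 A : model Sg0, countable_model A & models A G0.
Proof.
exists (Ak 0); first exact: dom_countable.
by move=> phi Gphi; apply/(@truth 0); exact: Th_Tr.
Qed.

End Chain.

Theorem theorem5p4 (Sg : signature) (hSg : countable_signature Sg)
    (G : set (sen Sg)) (hG : consistent G) :
  exists2 A : model Sg, countable_model A & models A G.
Proof.
have [c _] := countable_coding hSg.
(* The chain takes sorts and labels as parameters, so the signature is first split into its
   fields. *)
by case: Sg {hSg} G hG c => S F M L G hG c; exact: chain_model.
Qed.
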